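(* For a positive function $k$ on $[1,\infty)$, let $N(k)$ denote the set of $k$-near-perfect numbers. Suppose that for some $\epsilon>0$ the set $N((\log y)^{\log 2+\epsilon})$ has asymptotic density $c\in[0,1]$. Then for any positive strictly increasing function $k$ with $k(y)\ge(\log y)^{\log2+\epsilon}$ for all large $y$, the set $N(k)$ also has asymptotic density $c$.
   Context: Given a positive function $k$ on $[1,\infty)$, a natural number $n$ is $k$-near-perfect if $n$ equals the sum of all of its proper divisors except for at most $k(n)$ of them (the omitted ones are called redundant divisors). For the function $y\mapsto (\log y)^{\log2+\epsilon}$, $N((\log y)^{\log 2+\epsilon})$ is the set of $n$ that are near-perfect with at most $(\log n)^{\log2+\epsilon}$ exceptions. *)

(* Defs.v *)
From HB Require Import structures.
From mathcomp Require Import all_boot all_order all_algebra.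
From mathcomp Require Import all_classical all_reals all_analysis.
Set Implicit Arguments.
Unset Strict Implicit.
Unset Printing Implicit Defensive.
Import Order.TTheory GRing.Theory Num.Theory.
Import numFieldNormedType.Exports.
Local Open Scope classical_set_scope.
Local Open Scope ring_scope.

Definition proper_divisors (n : nat) : seq nat :=
  [seq d <- divisors n | (d < n)%N].

(* [s] lists the redundant divisors. Only values of [k] on [1, +oo) are used:
   [0] is excluded explicitly, since [divisors 0 = [::]] would admit it. *)
Definition near_perfect (R : realType) (k : R -> R) (n : nat) : Prop :=
  (0 < n)%N /\
  exists s : seq nat,
    [/\ uniq s,
        {subset s <= proper_divisors n},
        (size s)%:R <= k n%:R
      & n = (\sum_(d <- proper_divisors n | d \notin s) d)%N].

Definition near_perfect_set (R : realType) (k : R -> R) : set nat :=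
  [set n | near_perfect k n].

Definition counting_function (A : set nat) (N : nat) : nat :=
  (\sum_(1 <= n < N.+1 | n \in A) 1)%N.

Definition has_density (R : realType) (A : set nat) (c : R) : Prop :=
  ((counting_function A N)%:R / N%:R : R) @[N --> \oo] --> c.

(* Main.v *)
(* The two sets differ only at bounded n and at n with more than
   (log n)^(log 2 + eps) divisors; the latter have density 0, as follows.
   Writing a divisor as a squarefree part times a square gives
   d(n) <= r(n) 2^omega(n) with r(n) = #{m : m^2 | n}.  The average of r is
   bounded, so Markov's inequality handles r.  For a = 2^s - 1, expanding
   (1 + a)^omega(n) over sets of primes dividing n and using Rankin's trick with
   exponent sigma = 1 + 1/log N bounds its average over n <= N by
   e exp(a sum_{p <= N} p^(-sigma)) = O((log N)^a), since
   exp(sum p^(-sigma)) <= e^2 prod (1 + p^(-sigma)) <= e^2 zeta(sigma).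
   As 2^s - 1 = s log 2 + O(s^2), Markov's inequality with s small
   concludes. *)
Require Import Defs.
From HB Require Import structures.
From mathcomp Require Import all_boot all_order all_algebra.
From mathcomp Require Import all_classical all_reals all_analysis.
From mathcomp Require Import lra ring.
Set Implicit Arguments.
Unset Strict Implicit.
Unset Printing Implicit Defensive.
Import Order.TTheory GRing.Theory Num.Theory.
Import numFieldNormedType.Exports.
Local Open Scope classical_set_scope.
Local Open Scope ring_scope.

(** * Divisors as a squarefree part times a square *)

Definition primes_upto (N : nat) : {set 'I_N.+1} :=
  finset (fun p : 'I_N.+1 => prime p).

(** The bound [N] is kept apart from [n] so that the sets for all [n <= N] live in one finite type,
    where sums over [n] and over sets of primes can be exchanged. *)
Definition prime_divs (N n : nat) : {set 'I_N.+1} :=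
  finset (fun p : 'I_N.+1 => prime p && (p %| n)%N).

Definition sqdivs (N n : nat) : {set 'I_N.+1} :=
  finset (fun m : 'I_N.+1 => (0 < m)%N && (m ^ 2 %| n)%N).

Definition prodset (N : nat) (S : {set 'I_N.+1}) : nat := (\prod_(p in S) p)%N.

Lemma prodset_gt0 N (S : {set 'I_N.+1}) :
  S \subset primes_upto N -> (0 < prodset S)%N.
Proof.
move=> SP; apply: prodn_cond_gt0 => p pS.
by have := fintype.subsetP SP p pS; rewrite inE => /prime_gt0.
Qed.

Lemma prime_dvd_prodset N (S : {set 'I_N.+1}) (q : 'I_N.+1) :
  S \subset primes_upto N -> prime q -> (q %| prodset S)%N = (q \in S).
Proof.
move=> SP qp; apply/idP/idP; last by move=> qS; rewrite /prodset (bigD1 q)//= dvdn_mulr.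
rewrite /prodset Euclid_dvd_prod// big_has_cond => /hasP[p _ /andP[pS qdp]].
have pp : prime p by have := fintype.subsetP SP p pS; rewrite inE.
suff /val_inj -> : val q = val p by [].
by apply/eqP; rewrite -dvdn_prime2.
Qed.

(** A set of primes is recovered from its product as the set of primes dividing it. *)
Lemma prodset_inj N :
  {in powerset (primes_upto N) &, injective (@prodset N)}.
Proof.
move=> S S'; rewrite !inE => SP SP' eSS'; apply/setP => p.
case: (boolP (prime p)) => pp.
  by rewrite -(prime_dvd_prodset SP pp) -(prime_dvd_prodset SP' pp) eSS'.
have H (U : {set 'I_N.+1}) : U \subset primes_upto N -> p \in U = false.
  by move=> UP; apply/negP => /(fintype.subsetP UP); rewrite inE (negbTE pp).
by rewrite !H.
Qed.

(** Distinct primes are coprime, so Gauss's lemma adds them to the product one at a time. *)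
Lemma prodset_dvd N n (S : {set 'I_N.+1}) :
  S \subset prime_divs N n -> (prodset S %| n)%N.
Proof.
move=> /fintype.subsetP Sn.
have : forall p, p \in enum S -> prime (val p) && (val p %| n)%N.
  by move=> p; rewrite mem_enum => /Sn; rewrite inE.
rewrite /prodset -big_enum /=.
elim: (enum S) (enum_uniq S) => [_ _|q s IH /= /andP[qs us] H].
  by rewrite big_nil dvd1n.
rewrite big_cons Gauss_dvd; last first.
  rewrite big_seq; apply: (big_ind (coprime q)); first exact: coprimen1.
    by move=> x y qx qy; rewrite coprimeMr qx.
  move=> p ps.
  have /andP[pq _] := H q (mem_head _ _).
  have /andP[pp _] : prime p && (p %| n)%N by apply: H; rewrite in_cons ps orbT.
  rewrite prime_coprime// dvdn_prime2//.
  by apply: contra qs => /eqP/val_inj ->.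
have /andP[_ ->] := H q (mem_head _ _) => /=.
by apply: IH => // p ps; apply: H; rewrite in_cons ps orbT.
Qed.

(** Each exponent is split by parity: [S] collects the primes of odd exponent in [e], and [m]
    carries the halved exponents, rounded down. *)
Lemma sqfree_decomposition N e : (0 < e <= N)%N ->
  exists S : {set 'I_N.+1}, exists m : 'I_N.+1,
    [/\ S \subset prime_divs N e, m \in sqdivs N e & e = (prodset S * m ^ 2)%N].
Proof.
move=> /andP[e0 eN].
have pN p : p \in primes e -> (p < N.+1)%N.
  rewrite mem_primes ltnS => /and3P[_ _ pe].
  by apply: leq_trans eN; apply: dvdn_leq.
pose m := (\prod_(p <- primes e) p ^ (logn p e)./2)%N.
pose q := (\prod_(p <- primes e | odd (logn p e)) p)%N.
have eqm : e = (q * m ^ 2)%N.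
  rewrite {1}(prod_prime_decomp e0) prime_decompE big_map /=.
  rewrite /q /m [X in (X * _)%N]big_mkcond /= expnS expn1 -!big_split /=.
  apply: eq_bigr => p _; rewrite -[in LHS](odd_double_half (logn p e)).
  by rewrite expnD -addnn expnD; case: (odd _).
have mdvd : (m ^ 2 %| e)%N by rewrite [X in (_ %| X)%N]eqm dvdn_mull.
have m0 : (0 < m)%N.
  by case: (posnP m) eqm e0 => // ->; rewrite muln0 => ->.
have mN : (m < N.+1)%N.
  rewrite ltnS (leq_trans _ eN)// (leq_trans _ (dvdn_leq e0 mdvd))//.
  by rewrite expnS expn1 leq_pmulr.
pose S : {set 'I_N.+1} :=
  finset (fun p : 'I_N.+1 => ((p : nat) \in primes e) && odd (logn p e)).
exists S, (Ordinal mN); split.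
- apply/fintype.subsetP => p; rewrite !inE mem_primes => /andP[/and3P[-> _ ->]].
  by [].
- by rewrite inE /= m0.
- rewrite [LHS]eqm /=; congr (_ * _)%N.
  rewrite /prodset /S /q -big_filter.
  under [RHS]eq_bigl do rewrite inE.
  rewrite -[RHS]big_filter -[RHS](big_map (@nat_of_ord _) predT id) /=.
  apply: perm_big; apply: uniq_perm.
  + by rewrite filter_uniq// primes_uniq.
  + by rewrite map_inj_uniq ?filter_uniq ?index_enum_uniq//; apply: val_inj.
  + move=> p; apply/idP/mapP.
      rewrite mem_filter => /andP[oe pe].
      exists (Ordinal (pN p pe)) => //.
      by rewrite mem_filter mem_index_enum /= pe oe.
    case=> p'; rewrite mem_filter => /andP[/andP[pe oe] _] ->.
    by rewrite mem_filter oe pe.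
Qed.

(** Every divisor of [n] is the value of [F] at some pair in [X], so there are at most as many
    divisors as pairs. *)
Lemma size_divisors_le N n : (0 < n <= N)%N ->
  (size (divisors n) <= #|sqdivs N n| * 2 ^ #|prime_divs N n|)%N.
Proof.
move=> /andP[n0 nN].
pose F (x : 'I_N.+1 * {set 'I_N.+1}) := (prodset x.2 * x.1 ^ 2)%N.
pose X := finset.setX (sqdivs N n) (powerset (prime_divs N n)).
have -> : (#|sqdivs N n| * 2 ^ #|prime_divs N n|)%N = size (map F (enum X)).
  by rewrite size_map -cardE cardsX card_powerset.
apply: uniq_leq_size; first exact: divisors_uniq.
move=> e; rewrite -dvdn_divisors// => en.
have e0 : (0 < e)%N by apply: dvdn_gt0 en.
have eN : (e <= N)%N by apply: leq_trans nN; apply: dvdn_leq.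
have [|S [m [Se me eE]]] := @sqfree_decomposition N e; first by rewrite e0.
apply/mapP; exists (m, S) => //.
rewrite mem_enum inE /= !inE; apply/andP; split.
  move: me; rewrite inE => /andP[-> me]; exact: dvdn_trans en.
apply: (fintype.subset_trans Se); apply/fintype.subsetP => p.
rewrite !inE => /andP[-> pe].
exact: dvdn_trans en.
Qed.

(** * Finite sums and products *)

Lemma ler_sum_subseq (R : numDomainType) (I : eqType) (s t : seq I) (F : I -> R) :
  uniq s -> uniq t -> {subset s <= t} -> (forall i, 0 <= F i) ->
  \sum_(i <- s) F i <= \sum_(i <- t) F i.
Proof.
move=> us ut st F0; rewrite [leRHS](bigID (mem s)) /=.
rewrite -[X in _ <= X + _]big_filter.
rewrite (perm_big [seq i <- t | i \in s]) /=; last first.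
  apply: uniq_perm => //; first exact: filter_uniq.
  by move=> i; rewrite mem_filter; case: (boolP (i \in s)) => // /st ->.
by rewrite lerDl sumr_ge0.
Qed.

Lemma prod_1D_powerset (R : comNzRingType) (I : finType) (A : {set I}) (h : I -> R) :
  \prod_(i in A) (1 + h i) = \sum_(S in powerset A) \prod_(i in S) h i.
Proof.
(* Extending [h] by zero kills, in the expansion over all sets, those not contained in [A]. *)
pose F i := if i \in A then h i else 0.
transitivity (\prod_i (F i + 1)).
  rewrite big_mkcond /=; apply: eq_bigr => i _.
  by rewrite /F; case: ifP => _; rewrite ?add0r// addrC.
rewrite bigA_distr [RHS]big_mkcond /=; apply: eq_bigr => S _.
rewrite -big_mkcond /= inE; case: ifPn => [SA|].
  by apply: eq_bigr => i iS; rewrite /F (fintype.subsetP SA i iS).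
case/subsetPn => i iS iA.
by rewrite (bigD1 i)//= /F (negbTE iA) mul0r.
Qed.

Lemma sum_dvd_divn (N D : nat) : (0 < D)%N ->
  (\sum_(1 <= n < N.+1 | D %| n) 1 = N %/ D)%N.
Proof.
move=> D0; elim: N => [|N IH]; first by rewrite big_geq// div0n.
rewrite big_mkcond big_nat_recr//= -big_mkcond IH divnS// addnC.
by case: ifP.
Qed.

Lemma powR_natr_prod (R : realType) (I : Type) (s : seq I) (P : pred I)
    (F : I -> nat) (r : R) :
  (\prod_(i <- s | P i) F i)%N%:R `^ r = \prod_(i <- s | P i) ((F i)%:R `^ r).
Proof.
by apply: (big_morph (fun n : nat => n%:R `^ r)) => [x y|];
  rewrite ?natrM ?powRM ?powR1.
Qed.

(** * Partial zeta sums and sums over primes *)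

Lemma powR_telescope_le (R : realType) (x d : R) : 1 <= x -> 0 < d ->
  d * (x + 1) `^ (- (1 + d)) <= x `^ (- d) - (x + 1) `^ (- d).
Proof.
(* With u = 1 / (x + 1), x^(-d) = (x + 1)^(-d) (1 - u)^(-d), and
   (1 - u)^(-d) >= e^(d u) >= 1 + d u. *)
move=> x1 d0; have x0 : 0 < x by lra.
have y0 : 0 < x + 1 by lra.
have xE : (x + 1) `^ (- (1 + d)) = (x + 1) `^ (- d) / (x + 1).
  rewrite opprD powRD; last by apply/implyP => _; rewrite lt0r_neq0.
  by rewrite powR_inv1 ?ltW// mulrC.
set u := (x + 1)^-1 in xE *.
have u0 : 0 < u by rewrite invr_gt0.
have u1 : u < 1 by rewrite /u invf_lt1//; lra.
have xu : x = (x + 1) * (1 - u) by rewrite mulrBr mulr1 mulfV ?lt0r_neq0//; ring.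
have -> : x `^ (- d) = (x + 1) `^ (- d) * (1 - u) `^ (- d).
  by rewrite [in LHS]xu powRM//; lra.
have uge : 1 + d * u <= (1 - u) `^ (- d).
  rewrite /powR ifF; last by apply/negbTE; rewrite subr_eq0 gt_eqF.
  apply: le_trans (expR_ge1Dx _); rewrite lerD2l mulNr -mulrN ler_pM2l//.
  by rewrite lerNr le_ln1Dx// ltrNl opprK.
have := powR_ge0 (x + 1) (- d); rewrite xE; nra.
Qed.

Lemma zeta_partial_sum_le (R : realType) (d : R) (M : nat) : 0 < d ->
  \sum_(1 <= n < M.+1) n%:R `^ (- (1 + d)) <= 1 + d^-1.
Proof.
move=> d0; have di0 : 0 < d^-1 by rewrite invr_gt0.
case: M => [|M]; first by rewrite big_geq//; lra.
(* The induction needs the telescoped remainder, with equality for the single term [n = 1]. *)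
suff : \sum_(1 <= n < M.+2) n%:R `^ (- (1 + d)) <=
    1 + d^-1 - d^-1 * M.+1%:R `^ (- d).
  move=> /le_trans; apply; rewrite gerBl mulr_ge0 ?powR_ge0// ltW//.
elim: M => [|M IH]; first by rewrite big_nat1 !powR1; lra.
rewrite big_nat_recr//=.
have M1 : 1 <= M.+1%:R :> R by rewrite ler1n.
have := powR_telescope_le M1 d0.
rewrite -(ler_pM2l di0) mulrA mulVf ?lt0r_neq0// mul1r natr1.
move: IH; set A := \sum_(1 <= i < M.+2) _; set B := M.+1%:R `^ _; lra.
Qed.

(** With [v = x / (1 + x)] one has [x - x^2 <= v] and [e^v <= 1 / (1 - v) = 1 + x]. The quadratic
    loss is harmless for prime powers, whose squares have a bounded sum. *)
Lemma expR_le_1D (R : realType) (x : R) : 0 <= x -> expR x <= expR (x ^+ 2) * (1 + x).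
Proof.
move=> x0; have y0 : 0 < 1 + x by lra.
rewrite -[leLHS](_ : expR (x ^+ 2 + (x - x ^+ 2)) = _); last by congr expR; ring.
rewrite expRD ler_pM2l ?expR_gt0//.
set v := x / (1 + x).
have v0 : 1 - v = (1 + x)^-1 by rewrite /v; field; rewrite lt0r_neq0.
apply: (@le_trans _ _ (expR v)).
  rewrite ler_expR /v ler_pdivlMr//; nra.
rewrite -[leRHS]invrK -v0 -[leLHS]invrK -expRN lef_pV2 ?posrE ?expR_gt0//.
  exact: expR_ge1Dx.
by rewrite v0 invr_gt0.
Qed.

(** Expanding the product gives [n^(-(1 + d))] over the squarefree [n] built from primes up to [N].
    These [n] are distinct and at most [M], so a partial zeta sum dominates. *)
Lemma prod_primes_le (R : realType) (d : R) (N : nat) : 0 < d ->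
  \prod_(p in primes_upto N) (1 + p%:R `^ (- (1 + d))) <= 1 + d^-1.
Proof.
move=> d0; rewrite prod_1D_powerset.
under eq_bigr do rewrite -powR_natr_prod.
set M := prodset (primes_upto N).
apply: le_trans (zeta_partial_sum_le M d0).
set Q := powerset (primes_upto N).
rewrite -big_enum /= -(big_map (@prodset N) predT (fun n => n%:R `^ (- (1 + d)))) /=.
apply: ler_sum_subseq.
- rewrite map_inj_in_uniq ?enum_uniq// => S S'; rewrite !mem_enum.
  exact: prodset_inj.
- exact: iota_uniq.
- move=> n /mapP[S]; rewrite mem_enum inE => SP ->.
  rewrite mem_index_iota prodset_gt0//= ltnS dvdn_leq ?prodset_gt0//.
  rewrite /M /prodset [X in (_ %| X)%N](big_setID S) /=.
  by rewrite (finset.setIidPr SP) dvdn_mulr.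
- by move=> n; apply: powR_ge0.
Qed.

(** Bounding [p^(-2(1 + d))] by [p^(-2)] makes the estimate uniform in [d]; the zeta bound at
    exponent 2 gives the constant. *)
Lemma sum_primes_sq_le (R : realType) (d : R) (N : nat) : 0 < d ->
  \sum_(p in primes_upto N) (p%:R `^ (- (1 + d))) ^+ 2 <= 2.
Proof.
move=> d0; apply: (@le_trans _ _ (\sum_(1 <= n < N.+1) n%:R `^ (- (1 + 1)))).
  rewrite -big_enum /=.
  apply: (@le_trans _ _ (\sum_(p <- enum (primes_upto N)) (p%:R `^ (- (1 + 1))))).
    rewrite big_seq [leRHS]big_seq; apply: ler_sum => p.
    rewrite mem_enum inE => pp.
    have p1 : 1 <= (p : nat)%:R :> R by rewrite ler1n prime_gt0.
    rewrite -powR_mulrn ?powR_ge0// -powRrM ler_powR//; lra.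
  rewrite -(big_map (@nat_of_ord _) predT (fun n => n%:R `^ (- (1 + 1)))) /=.
  apply: ler_sum_subseq.
  - by rewrite map_inj_uniq ?enum_uniq//; apply: val_inj.
  - exact: iota_uniq.
  - move=> n /mapP[p]; rewrite mem_enum inE => pp ->.
    by rewrite mem_index_iota prime_gt0//= ltn_ord.
  - by move=> n; apply: powR_ge0.
by apply: le_trans (zeta_partial_sum_le N ltr01) _; rewrite invr1.
Qed.

Lemma expR_sum_primes_le (R : realType) (d : R) (N : nat) : 0 < d ->
  expR (\sum_(p in primes_upto N) p%:R `^ (- (1 + d))) <= expR 2 * (1 + d^-1).
Proof.
move=> d0; rewrite expR_sum.
apply: (@le_trans _ _ (\prod_(p in primes_upto N)
   (expR ((p%:R `^ (- (1 + d))) ^+ 2) * (1 + p%:R `^ (- (1 + d)))))).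
  by apply: ler_prod => p _; rewrite expR_ge0 expR_le_1D// powR_ge0.
rewrite big_split /= -expR_sum.
apply: ler_pM; rewrite ?expR_ge0 ?prod_primes_le//.
  by apply: prodr_ge0 => p _; rewrite addr_ge0 ?powR_ge0.
by rewrite ler_expR sum_primes_sq_le.
Qed.

(** * Rankin's trick and averages over n up to N *)

(** For [D <= N] the extra factor [D^(-1 / ln N)] is at least [1 / e], which [expR 1] compensates;
    for [D > N] the quotient is 0. *)
Lemma divn_le_rankin (R : realType) (N D : nat) : (1 < N)%N -> (0 < D)%N ->
  (N %/ D)%N%:R <= expR 1 * N%:R * D%:R `^ (- (1 + (ln N%:R)^-1)) :> R.
Proof.
move=> N1 D0; have D0' : 0 < D%:R :> R by rewrite ltr0n.
have N0 : 0 < N%:R :> R by rewrite ltr0n; case: N N1.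
case: (ltnP N D) => [ND|DN].
  by rewrite divn_small//= !mulr_ge0// ?expR_ge0 ?powR_ge0.
have lnN : 0 < ln N%:R :> R by rewrite ln_gt0// ltr1n.
rewrite opprD powRD; last by apply/implyP => _; rewrite lt0r_neq0.
rewrite (powR_inv1 (ltW D0')) /powR (gt_eqF D0').
have -> : expR 1 * N%:R * (D%:R^-1 * expR (- (ln N%:R)^-1 * ln D%:R)) =
   N%:R / D%:R * expR (1 - (ln N%:R)^-1 * ln D%:R) :> R.
  by rewrite expRD mulNr; ring.
apply: (@le_trans _ _ (N%:R / D%:R)).
  by rewrite ler_pdivlMr// -natrM ler_nat leq_divM.
rewrite ler_peMr ?divr_ge0//.
rewrite -[leLHS]expR0 ler_expR subr_ge0 mulrC ler_pdivrMr// mul1r.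
by rewrite ler_ln ?posrE// ler_nat.
Qed.

Lemma sum_exp_omega_le (R : realType) (a : R) (N : nat) : 0 <= a -> (1 < N)%N ->
  \sum_(1 <= n < N.+1) (1 + a) ^+ #|prime_divs N n| <=
  expR 1 * N%:R * (expR 2 * (1 + ln N%:R)) `^ a.
Proof.
move=> a0 N1.
have lnN : 0 < ln N%:R :> R by rewrite ln_gt0// ltr1n.
have d0 : 0 < (ln N%:R)^-1 :> R by rewrite invr_gt0.
set d : R := (ln N%:R)^-1 in d0.
have cN (S : {set 'I_N.+1}) : S \in powerset (primes_upto N) ->
  \sum_(1 <= n < N.+1 | S \subset prime_divs N n) 1 <=
    expR 1 * N%:R * (prodset S)%:R `^ (- (1 + d)) :> R.
  rewrite inE => SP; apply: le_trans (divn_le_rankin R N1 (prodset_gt0 SP)).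
  rewrite -sum_dvd_divn ?prodset_gt0// natr_sum big_mkcond [leRHS]big_mkcond /=.
  apply: ler_sum => n _; case: ifPn => [/prodset_dvd -> //|_].
  by case: ifP.
(* An equality in fact: [(1 + a)^omega(n)] is the sum of [a^|S|] over sets [S] of primes dividing
   [n], and the two sums are exchanged. *)
apply: (@le_trans _ _ (\sum_(S in powerset (primes_upto N)) a ^+ #|S| *
   \sum_(1 <= n < N.+1 | S \subset prime_divs N n) 1)).
  rewrite le_eqVlt; apply/orP; left; apply/eqP.
  under [RHS]eq_bigr do rewrite mulr_sumr big_mkcond.
  rewrite exchange_big /=; apply: eq_bigr => n _.
  rewrite -prodr_const prod_1D_powerset big_mkcond [RHS]big_mkcond /=.
  apply: eq_bigr => S _; rewrite !inE mulr1 prodr_const.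
  case: ifPn => [Sn|_]; last by case: ifP.
  rewrite (fintype.subset_trans Sn)//.
  by apply/fintype.subsetP => p; rewrite !inE => /andP[].
apply: (@le_trans _ _ (\sum_(S in powerset (primes_upto N)) expR 1 * N%:R *
   \prod_(p in S) (a * p%:R `^ (- (1 + d))))).
  apply: ler_sum => S SP; rewrite big_split /= prodr_const -powR_natr_prod.
  by rewrite mulrCA ler_wpM2l ?exprn_ge0// cN.
rewrite -mulr_sumr -prod_1D_powerset ler_wpM2l ?mulr_ge0 ?expR_ge0//.
(* The inequality [1 + x <= e^x], applied to each factor, brings in the prime sum already
   bounded. *)
apply: (@le_trans _ _ (expR (\sum_(p in primes_upto N) p%:R `^ (- (1 + d))) `^ a)).
  rewrite -expRM mulrC mulr_sumr expR_sum; apply: ler_prod => p _.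
  by rewrite expR_ge1Dx addr_ge0 ?mulr_ge0 ?powR_ge0.
apply: ge0_ler_powR => //; rewrite ?nnegrE ?expR_ge0//.
  by rewrite mulr_ge0 ?expR_ge0// addr_ge0// ltW.
by have := expR_sum_primes_le N d0; rewrite /d invrK.
Qed.

(** After exchanging the sums, each [m > 0] contributes [N %/ m^2 <= N m^(-2)]. *)
Lemma sum_sqdivs_le (R : realType) (N : nat) :
  \sum_(1 <= n < N.+1) #|sqdivs N n|%:R <= 2 * N%:R :> R.
Proof.
under eq_bigr do rewrite -sum1_card big_mkcond natr_sum.
rewrite exchange_big /=.
apply: (@le_trans _ _ (\sum_(m < N.+1 | (0 < m)%N) N%:R * m%:R `^ (- (1 + 1)))).
  rewrite [leRHS]big_mkcond; apply: ler_sum => m _.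
  case: ifPn => m0; last first.
    rewrite big1// => n _; rewrite inE (negbTE m0)//.
  have m0' : 0 < (m : nat)%:R :> R by rewrite ltr0n.
  under eq_bigr do rewrite inE m0 /=.
  rewrite -natr_sum -big_mkcond sum_dvd_divn ?expn_gt0 ?m0//.
  rewrite powRN -[1 + 1]/(2%:R) (powR_mulrn _ (ltW m0')) ler_pdivlMr ?exprn_gt0//.
  by rewrite -natrX -natrM ler_nat leq_divM.
rewrite -mulr_sumr mulrC ler_wpM2r//.
apply: le_trans (_ : 1 + 1^-1 <= 2); last by rewrite invr1.
apply: le_trans (zeta_partial_sum_le N ltr01).
rewrite -(big_mkord (fun m => (0 < m)%N) (fun m => m%:R `^ (- (1 + 1)))).
rewrite big_ltn_cond//= big_nat_cond [leRHS]big_nat_cond le_eqVlt.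
apply/orP; left; apply/eqP/eq_bigl => m.
by rewrite andbT; case: posnP => [->|m0]; rewrite ?andbT// andbF.
Qed.

Lemma count_le_ub (R : realType) (N : nat) (y : R) : 0 <= y ->
  \sum_(1 <= n < N.+1 | n%:R <= y) 1 <= y.
Proof.
move=> y0; elim: N => [|N IH]; first by rewrite big_geq.
have [yN|Ny] := leP N.+1%:R y.
  apply: le_trans yN; rewrite big_mkcond /=.
  apply: (@le_trans _ _ (\sum_(1 <= n < N.+2) 1)).
    by apply: ler_sum => n _; case: ifP.
  by rewrite big_const_nat subn1 iter_addr_0.
rewrite big_mkcond big_nat_recr//= -big_mkcond [X in _ + X]ifF ?addr0//.
by apply/negbTE; rewrite -ltNge.
Qed.

Lemma markov_count (R : realType) (N : nat) (F : nat -> R) (T : R) :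
  0 < T -> (forall n, 0 <= F n) ->
  \sum_(1 <= n < N.+1 | T < F n) 1 <= (\sum_(1 <= n < N.+1) F n) / T.
Proof.
move=> T0 F0; rewrite ler_pdivlMr// mulr_suml big_mkcond /=.
apply: ler_sum => n _; case: ifP => // TF; by rewrite mul1r ltW.
Qed.

(** * Limits at infinity *)

Lemma cvg_ln_pinfty (R : realType) : ln x @[x --> +oo] --> (+oo : set_system R).
Proof.
apply/cvgryPge => A; near=> x.
by rewrite -[A]expRK ler_ln ?posrE ?expR_gt0//.
Unshelve. all: by end_near. Qed.

Lemma cvg_powRN (R : realType) (h : R) : 0 < h -> x `^ (- h) @[x --> +oo] --> 0.
Proof.
move=> h0; apply: (@cvg_trans _ (expR (- (h * ln x)) @[x --> +oo])).
  apply: near_eq_cvg; near=> x.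
  by rewrite /powR gt_eqF ?mulNr.
apply: (@cvg_comp _ _ _ (fun x => h * ln x) (fun x => expR (- x)) _ _ _ _ (@cvgr_expR R)).
apply/cvgryPge => A; near=> x.
rewrite mulrC -ler_pdivrMr//; near: x.
by move/cvgryPge: (@cvg_ln_pinfty R); apply.
Unshelve. all: by end_near. Qed.

(** * Integers with many divisors *)

Lemma expR_moment_exponent (R : realType) (eps : R) : 0 < eps -> exists s : R,
  0 < s /\ 2 `^ s - 1 < s * (ln 2 + eps).
Proof.
move=> eps0.
have l0 : 0 < ln 2 :> R by rewrite ln_gt0// ltr1n.
have l1 : ln 2 <= 1 :> R by have := @le_ln1Dx R 1; rewrite -[1 + 1]/(2%:R); apply; lra.
(* With [u = s ln 2 <= s], the bound [s <= 1/2] gives [e^u <= 1 / (1 - u) <= 1 + u + 2 u^2], and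
   [s <= eps / 4] gives [2 u^2 <= s eps / 2]. *)
exists (Num.min 2^-1 (eps / 4)); set s := Num.min _ _.
have s0 : 0 < s by rewrite lt_min; apply/andP; split; lra.
have s1 : s <= 2^-1 by rewrite ge_min lexx.
have s2 : s <= eps / 4 by rewrite ge_min lexx orbT.
split=> //; rewrite /powR ifF ?gt_eqF//.
set u := s * ln 2.
have u0 : 0 < u by rewrite mulr_gt0.
have us : u <= s by rewrite /u; nra.
have : (1 - u) * expR u <= 1.
  rewrite -[X in _ <= X](@expRxMexpNx_1 R u) mulrC ler_pM2l ?expR_gt0//.
  exact: expR_ge1Dx.
have e0 := expR_gt0 u.
have uu : u ^+ 2 <= s * s by rewrite expr2; nra.
move=> H.
have : expR u <= 1 + u + 2 * u ^+ 2.
  have H1 : 1 <= (1 - u) * (1 + u + 2 * u ^+ 2) by nra.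
  rewrite -(@ler_pM2l _ (1 - u)); lra.
rewrite mulrDr -/u; nra.
Qed.

(** The exponent [ln 2 + eps] is split into [eps / 2] for the square divisors and
    [g = ln 2 + eps / 2] for [2^omega(n)]. Thresholds are powers of [T = ln N / 2], independent of
    [n], since [T <= ln n] once [n > N / T]. *)
Lemma many_divisors_count (R : realType) (eps : R) : 0 < eps ->
  exists C h : R, 0 < h /\ forall N : nat, 1 <= ln N%:R / 2 :> R ->
  \sum_(1 <= n < N.+1 | ln n%:R `^ (ln 2 + eps) < (size (divisors n))%:R) 1 <=
  N%:R * ((ln N%:R / 2) `^ (- 1) + 2 * (ln N%:R / 2) `^ (- (eps / 2)) +
          C * (ln N%:R / 2) `^ (- h)) :> R.
Proof.
move=> eps0; have e20 : 0 < eps / 2 by rewrite divr_gt0.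
have [s [s0 sP]] := expR_moment_exponent e20.
have l0 : 0 < ln 2 :> R by rewrite ln_gt0// ltr1n.
set a := 2 `^ s - 1 in sP.
set g := ln 2 + eps / 2 in sP.
have a0 : 0 <= a.
  by rewrite subr_ge0 -[leLHS](@powRr0 R 2) ler_powR ?ler1n// ltW.
(* The 3 comes from [1 + ln N = 1 + 2 T <= 3 T]; [h] is the gap between the Markov threshold
   [T^(s g)] and the moment of order [T^a]. *)
exists (expR 1 * (expR 2 * 3) `^ a), (s * g - a); split; first by rewrite subr_gt0.
move=> N; set T := ln N%:R / 2 => T1.
have T0 : 0 < T by lra.
have lnN : ln N%:R = 2 * T by rewrite /T; field.
have N1 : (1 < N)%N.
  rewrite -(ltr1n R) ltNge; apply/negP => /ln_le0; lra.
have N0 : 0 < N%:R :> R by rewrite ltr0n; case: N N1 {T T1 T0 lnN}.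
(* Every [n] with too many divisors is small, has many square divisors, or has many prime
   factors. *)
pose A1 := \sum_(1 <= n < N.+1 | n%:R <= N%:R / T) 1 : R.
pose A2 := \sum_(1 <= n < N.+1 | T `^ (eps / 2) < #|sqdivs N n|%:R) 1 : R.
pose A3 := \sum_(1 <= n < N.+1 | T `^ (s * g) < (1 + a) ^+ #|prime_divs N n|) 1 : R.
have B1 : A1 <= N%:R * T `^ (- 1).
  by rewrite (powR_inv1 (ltW T0)); apply: count_le_ub; rewrite ltW// divr_gt0.
have B2 : A2 <= N%:R * (2 * T `^ (- (eps / 2))).
  apply: le_trans (markov_count _ _ _) _; rewrite ?powR_gt0//.
  by rewrite powRN mulrA ler_wpM2r ?invr_ge0 ?powR_ge0// mulrC sum_sqdivs_le.
have B3 : A3 <= N%:R * (expR 1 * (expR 2 * 3) `^ a * T `^ (- (s * g - a))).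
  have a10 : 0 <= 1 + a by lra.
  apply: le_trans (markov_count _ _ _) _; rewrite ?powR_gt0//.
    by move=> n; rewrite exprn_ge0.
  rewrite ler_pdivrMr ?powR_gt0//.
  apply: le_trans (sum_exp_omega_le a0 N1) _.
  rewrite -!mulrA -powRD; last by apply/implyP => _; rewrite gt_eqF.
  rewrite (_ : - (s * g - a) + s * g = a); last by ring.
  rewrite mulrCA ler_pM2l// ler_pM2l ?expR_gt0//.
  have e2 := expR_gt0 (2 : R).
  have le3 : expR 2 * (1 + ln N%:R) <= expR 2 * 3 * T by rewrite lnN; nra.
  rewrite -powRM; [|by nra|exact: ltW].
  apply: ge0_ler_powR => //; rewrite nnegrE ?lnN; nra.
apply: (@le_trans _ _ (A1 + A2 + A3)).
  2: by rewrite 2!mulrDr; apply: lerD => //; apply: lerD.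
rewrite /A1 /A2 /A3 big_mkcond [X in _ <= X + _ + _]big_mkcond.
rewrite [X in _ <= _ + X + _]big_mkcond [X in _ <= _ + X]big_mkcond -!big_split /=.
rewrite big_nat_cond [leRHS]big_nat_cond.
apply: ler_sum => n /andP[/andP[n0 nN] _].
case: ifP => [nB|_]; last by do 3 case: ifP => _; lra.
case: ifPn => [_|]; first by do 2 case: ifP => _; lra.
rewrite -ltNge => nT.
case: ifPn => [_|]; first by case: ifP => _; lra.
rewrite -leNgt => rT.
rewrite ifT ?add0r//; rewrite ltNge; apply/negP => oT.
(* As [1 + a = 2^s], taking [s]-th roots turns the threshold [T^(s g)] into [T^g] for
   [2^omega(n)]. *)
have oT' : (2 ^ #|prime_divs N n|)%N%:R <= T `^ g.
  have x0 : 0 <= (2 ^ #|prime_divs N n|)%N%:R :> R by [].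
  rewrite leNgt; apply/negP => H; move: oT; apply/negP; rewrite -ltNge.
  have -> : (1 + a) ^+ #|prime_divs N n| = (2 ^ #|prime_divs N n|)%N%:R `^ s.
    rewrite natrX -(powR_mulrn _ (ler0n R 2)) powRAC powR_mulrn ?powR_ge0//.
    by congr (_ ^+ _); rewrite /a; ring.
  rewrite [s * g]mulrC powRrM.
  by apply: gt0_ltr_powR => //; rewrite ?nnegrE ?powR_ge0.
have n0R : 0 < n%:R :> R by rewrite ltr0n.
(* Here [ln n >= ln N - ln T >= 2 T - (T - 1)]. *)
have Tn : T <= ln n%:R.
  have : ln (N%:R / T) <= ln n%:R :> R.
    by rewrite ler_ln ?posrE ?(divr_gt0 N0 T0)// ltW.
  rewrite ln_div ?posrE// lnN => H.
  have : ln T <= T - 1.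
    by rewrite -{1}(_ : 1 + (T - 1) = T) ?le_ln1Dx//; [lra|ring].
  lra.
move: nB; apply/negP; rewrite -leNgt.
apply: (@le_trans _ _ (T `^ (ln 2 + eps))); last first.
  by apply: ge0_ler_powR => //; rewrite ?nnegrE; lra.
rewrite (_ : ln 2 + eps = eps / 2 + g); last by rewrite /g; field.
rewrite powRD; last by apply/implyP => _; rewrite gt_eqF.
apply: (@le_trans _ _ (#|sqdivs N n|%:R * (2 ^ #|prime_divs N n|)%N%:R)).
  by rewrite -natrM ler_nat size_divisors_le// n0.
by apply: ler_pM.
Qed.

(** * Transfer of the density *)

Theorem theorem1p5 (R : realType) (eps c : R)
  (eps_gt0 : 0 < eps)
  (c_ge0 : 0 <= c) (c_le1 : c <= 1)
  (density_log :
    has_density (near_perfect_set (fun y : R => ln y `^ (ln 2 + eps))) c)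
  (k : R -> R)
  (k_gt0 : forall y : R, 1 <= y -> 0 < k y)
  (k_incr : forall x y : R, 1 <= x -> x < y -> k x < k y)
  (k_large : \forall y \near +oo, ln y `^ (ln 2 + eps) <= k y) :
  has_density (near_perfect_set k) c.
Proof.
set k1 := fun y : R => ln y `^ (ln 2 + eps) in density_log.
have [N0 N0P] : exists N0 : nat, forall n, (N0 < n)%N -> k1 n%:R <= k n%:R.
  case: k_large => M [_ MP].
  exists (Num.truncn `|M|) => n Mn; apply: MP.
  by apply: le_lt_trans (ler_norm M) _; rewrite -truncn_lt_nat.
have [C [h [h0 CP]]] := many_divisors_count eps_gt0.
pose T (N : nat) : R := ln N%:R / 2.
(* The first term pays for [n <= N0], the rest for the [n] with more than [k1 n] divisors. *)
pose w (N : nat) : R := N0%:R / N%:R + (T N `^ (- 1) +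
   2 * T N `^ (- (eps / 2)) + C * T N `^ (- h)).
(* For such [n] both bounds are at least the number of divisors, so neither restricts the list of
   redundant divisors. *)
have sym n : (N0 < n)%N -> ~~ (k1 n%:R < (size (divisors n))%:R) ->
    (n \in near_perfect_set k) = (n \in near_perfect_set k1).
  move=> nN0; rewrite -leNgt => dn; apply/idP/idP;
    rewrite !inE => -[n0 [s [us sub sk ns]]].
    split=> //; exists s; split=> //; apply: le_trans dn; rewrite ler_nat.
    apply: uniq_leq_size => // x /sub; rewrite mem_filter => /andP[_ ?] //.
  by split=> //; exists s; split=> //; apply: le_trans sk (N0P _ nN0).
have diff (N : nat) : 1 <= T N ->
    `|(counting_function (near_perfect_set k) N)%:R / N%:R -
      (counting_function (near_perfect_set k1) N)%:R / N%:R| <= w N.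
  move=> TN.
  (* By the convention [ln 0 = 0], the case [N = 0] contradicts [1 <= T N]. *)
  have Npos : 0 < N%:R :> R.
    by rewrite ltr0n lt0n; apply/negP => /eqP N0'; move: TN; rewrite /T N0' ln0//; lra.
  rewrite -mulrBl normrM normfV (gtr0_norm Npos) ler_pdivrMr//.
  rewrite /w mulrDl mulfVK ?gt_eqF// [X in _ <= _ + X]mulrC.
  apply: le_trans (lerD (count_le_ub N (ler0n R N0)) (CP N TN)).
  rewrite /counting_function !natr_sum big_mkcond [X in `|_ - X|]big_mkcond /=.
  rewrite -sumrB; apply: le_trans (ler_norm_sum _ _ _) _.
  rewrite [X in _ <= X + _]big_mkcond [X in _ <= _ + X]big_mkcond -big_split /=.
  (* The indicators differ by at most 1, and by [sym] only at an [n] counted on the right. *)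
  apply: ler_sum => n _; rewrite ler_nat.
  have [nN0|nN0] := leqP n N0.
    by do 3 case: ifP => _; rewrite ?subrr ?subr0 ?sub0r ?normrN ?normr1 ?normr0; lra.
  have [_|dn] := boolP (k1 n%:R < (size (divisors n))%:R); last first.
    by rewrite (sym n nN0 dn) subrr normr0 addr0.
  by do 2 case: ifP => _; rewrite ?subrr ?subr0 ?sub0r ?normrN ?normr1 ?normr0; lra.
have cvgT : T N @[N --> \oo] --> +oo.
  apply/cvgryPge => A; near=> N; rewrite /T ler_pdivlMr//.
  near: N; move/cvgryPge: (cvg_comp _ _ (@cvgr_idn R) (@cvg_ln_pinfty R)).
  exact.
have cvgp (b : R) : 0 < b -> T N `^ (- b) @[N --> \oo] --> 0.
  by move=> b0; apply: (cvg_comp _ _ cvgT (cvg_powRN b0)).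
have w0 : w N @[N --> \oo] --> 0.
  rewrite -[0](_ : N0%:R * 0 + (0 + 2 * 0 + C * 0) = 0 :> R); last by ring.
  apply: cvgD; last apply: cvgD; first last.
  - by apply: cvgMr; apply: cvgp.
  - apply: cvgD; first exact: cvgp.
    by apply: cvgMr; apply: cvgp; rewrite divr_gt0.
  - apply: cvgMr; apply/gtr0_cvgV0; last exact: cvgr_idn.
    by near=> N; rewrite ltr0n; near: N; exact: nbhs_infty_gt.
have dk : (counting_function (near_perfect_set k) N)%:R / N%:R -
    (counting_function (near_perfect_set k1) N)%:R / N%:R @[N --> \oo] --> (0 : R).
  apply/norm_cvg0P; apply: (squeeze_cvgr _ (cvg_cst 0) w0).
  near=> N; rewrite normr_ge0/=; apply: diff.
  by near: N; move/cvgryPge: cvgT; apply.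
rewrite /has_density -[c]add0r.
rewrite (_ : (fun N => _) = fun N : nat =>
  ((counting_function (near_perfect_set k) N)%:R / N%:R -
   (counting_function (near_perfect_set k1) N)%:R / N%:R : R) +
  (counting_function (near_perfect_set k1) N)%:R / N%:R); first exact: cvgD.
by apply/funext => N; rewrite subrK.
Unshelve. all: by end_near. Qed.
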